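(* Let $H$, $G$ be two groups and let $\alpha:G\times H\to H$, $\alpha(g,h)=g\rhd h$, be an action of $G$ on $H$ by group automorphisms. Let $\alpha':G\times H\to H$, $\alpha'(g,h)=g\rhd'h$, and $\beta':G\times H\to G$ be two maps. The following statements are equivalent: (1) $(H,G,\alpha',\beta')$ is a matched pair of groups and there exists an isomorphism of groups $H\,{}_{\alpha'}\!\bowtie_{\beta'}G\cong H\,{}_{\alpha}\!\ltimes G$ that fixes $H$. (2) $\beta'$ is the trivial action (i.e. $\beta'(g,h)=g$ for all $g\in G$, $h\in H$) and there exists a pair $(r,v)$, where $v\in\mathrm{Aut}(G)$ and $r:G\to H$ is a map such that $$r(g_1g_2)=r(g_1)\bigl(v(g_1)\rhd r(g_2)\bigr)$$ for all $g_1,g_2\in G$, and $\alpha'$ is given by $$g\rhd'h=r(g)\,(v(g)\rhd h)\,r(g)^{-1}$$ for all $g\in G$, $h\in H$. The isomorphism $\psi:H\,{}_{\alpha'}\!\bowtie_{\beta'}G\to H\,{}_{\alpha}\!\ltimes G$ fixing $H$ is given by $\psi(h,g)=(h\,r(g),v(g))$ for all $h\in H$, $g\in G$.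
   Context: A matched pair of groups $(H,G,\alpha',\beta')$ consists of groups $H$, $G$, a left action $\alpha'(g,h)=g\rhd'h$ of the group $G$ on the set $H$, and a right action $\beta'(g,h)=g\lhd'h$ of the group $H$ on the set $G$, such that for all $g,g_1,g_2\in G$, $h,h_1,h_2\in H$: $g\rhd'(h_1h_2)=(g\rhd'h_1)\bigl((g\lhd'h_1)\rhd'h_2\bigr)$ and $(g_1g_2)\lhd'h=\bigl(g_1\lhd'(g_2\rhd'h)\bigr)(g_2\lhd'h)$. The bicrossed product $H\,{}_{\alpha'}\!\bowtie_{\beta'}G$ is the group on the set $H\times G$ with unit $(1_H,1_G)$ and multiplication $(h_1,g_1)(h_2,g_2)=\bigl(h_1(g_1\rhd'h_2),\,(g_1\lhd'h_2)g_2\bigr)$. $H\,{}_{\alpha}\!\ltimes G$ is the left version of the semidirect product: the set $H\times G$ with multiplication $(h_1,g_1)(h_2,g_2)=(h_1(g_1\rhd h_2),\,g_1g_2)$. A morphism $\psi$ between two such groups fixes $H$ if $\psi(h,1)=(h,1)$ for all $h\in H$. *)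

(* Defs.v *)
From HB Require Import structures.
From mathcomp Require Import all_boot.

Set Implicit Arguments.
Unset Strict Implicit.
Unset Printing Implicit Defensive.

Local Open Scope group_scope.

Definition group_isom (A B : groupType) (f : A -> B) : Prop :=
  monoid_morphism f /\ bijective f.

Record left_action (G : groupType) (X : Type) (a : G -> X -> X) : Prop :=
  LeftAction {
    lact1 : forall x, a 1 x = x;
    lactM : forall g1 g2 x, a (g1 * g2) x = a g1 (a g2 x)
  }.

Record right_action (H : groupType) (X : Type) (b : X -> H -> X) : Prop :=
  RightAction {
    ract1 : forall x, b x 1 = x;
    ractM : forall x h1 h2, b x (h1 * h2) = b (b x h1) h2
  }.

Record autom_action (H G : groupType) (a : G -> H -> H) : Prop :=
  AutomAction {
    aact_left : left_action a;
    aact_autom : forall g, group_isom (a g)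
  }.

Record matched_pair (H G : groupType) (a : G -> H -> H) (b : G -> H -> G) : Prop :=
  MatchedPair {
    mp_left : left_action a;
    mp_right : right_action b;
    mp_mull : forall g h1 h2, a g (h1 * h2) = a g h1 * a (b g h1) h2;
    mp_mulr : forall g1 g2 h, b (g1 * g2) h = b g1 (a g2 h) * b g2 h
  }.

(* The carriers below are aliases of [H * G], so that the group laws declared
   on them do not compete with the library's direct product law on [H * G]. *)
Definition bicrossed (H G : groupType) (a : G -> H -> H) (b : G -> H -> G)
  (mp : matched_pair a b) : Type := (H * G)%type.

Section Bicrossed.
Variables (H G : groupType) (a : G -> H -> H) (b : G -> H -> G).
Variable mp : matched_pair a b.
Local Notation T := (bicrossed mp).
Implicit Types x y z : T.

Definition bicrossed_one : T := (1, 1).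
Definition bicrossed_mul x y : T := (x.1 * a x.2 y.1, b x.2 y.1 * y.2).
Definition bicrossed_inv x : T := (a x.2^-1 x.1^-1, b x.2^-1 x.1^-1).

Lemma mp_act1 g : a g 1 = 1.
Proof.
have := mp_mull mp g 1 1.
by rewrite mulg1 (ract1 (mp_right mp)) => E; apply: (mulgI (a g 1)); rewrite -E mulg1.
Qed.

Lemma mp_1act h : b 1 h = 1.
Proof.
have := mp_mulr mp 1 1 h.
by rewrite mulg1 (lact1 (mp_left mp)) => E; apply: (mulgI (b 1 h)); rewrite -E mulg1.
Qed.

Lemma bicrossed_mulA : associative bicrossed_mul.
Proof.
move=> [h1 g1] [h2 g2] [h3 g3]; rewrite /bicrossed_mul /=; congr (_, _).
  by rewrite (mp_mull mp) (lactM (mp_left mp)) mulgA.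
by rewrite (mp_mulr mp) (ractM (mp_right mp)) mulgA.
Qed.

Lemma bicrossed_mul1x : left_id bicrossed_one bicrossed_mul.
Proof.
by move=> [h g]; rewrite /bicrossed_mul /= (lact1 (mp_left mp)) mp_1act !mul1g.
Qed.

Lemma bicrossed_mulx1 : right_id bicrossed_one bicrossed_mul.
Proof.
by move=> [h g]; rewrite /bicrossed_mul /= (ract1 (mp_right mp)) mp_act1 !mulg1.
Qed.

Lemma bicrossed_mulVx : left_inverse bicrossed_one bicrossed_inv bicrossed_mul.
Proof.
move=> [h g]; rewrite /bicrossed_mul /bicrossed_one /=; congr (_, _).
  by rewrite -(mp_mull mp) mulVg mp_act1.
by rewrite -(ractM (mp_right mp)) mulVg (ract1 (mp_right mp)) mulVg.
Qed.

Lemma bicrossed_mulxV : right_inverse bicrossed_one bicrossed_inv bicrossed_mul.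
Proof.
move=> [h g]; rewrite /bicrossed_mul /bicrossed_one /=; congr (_, _).
  by rewrite -(lactM (mp_left mp)) mulgV (lact1 (mp_left mp)) mulgV.
by rewrite -(mp_mulr mp) mulgV mp_1act.
Qed.

HB.instance Definition _ := Choice.copy T (H * G)%type.
HB.instance Definition _ := isGroup.Build T
  bicrossed_mulA bicrossed_mul1x bicrossed_mulx1 bicrossed_mulVx bicrossed_mulxV.
End Bicrossed.

Definition semidirect (H G : groupType) (a : G -> H -> H)
  (aa : autom_action a) : Type := (H * G)%type.

Section Semidirect.
Variables (H G : groupType) (a : G -> H -> H).
Variable aa : autom_action a.
Local Notation T := (semidirect aa).
Implicit Types x y z : T.

Definition semidirect_one : T := (1, 1).
Definition semidirect_mul x y : T := (x.1 * a x.2 y.1, x.2 * y.2).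
Definition semidirect_inv x : T := (a x.2^-1 x.1^-1, x.2^-1).

Lemma aact1 g : a g 1 = 1.
Proof. by case: (aact_autom aa g) => -[]. Qed.

Lemma aactM g h1 h2 : a g (h1 * h2) = a g h1 * a g h2.
Proof. by case: (aact_autom aa g) => -[_ ->]. Qed.

Lemma semidirect_mulA : associative semidirect_mul.
Proof.
move=> [h1 g1] [h2 g2] [h3 g3]; rewrite /semidirect_mul /=.
by rewrite aactM (lactM (aact_left aa)) !mulgA.
Qed.

Lemma semidirect_mul1x : left_id semidirect_one semidirect_mul.
Proof.
by move=> [h g]; rewrite /semidirect_mul /= (lact1 (aact_left aa)) !mul1g.
Qed.

Lemma semidirect_mulx1 : right_id semidirect_one semidirect_mul.
Proof. by move=> [h g]; rewrite /semidirect_mul /= aact1 !mulg1. Qed.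

Lemma semidirect_mulVx :
  left_inverse semidirect_one semidirect_inv semidirect_mul.
Proof.
move=> [h g]; rewrite /semidirect_mul /semidirect_one /=.
by rewrite -aactM !mulVg aact1.
Qed.

Lemma semidirect_mulxV :
  right_inverse semidirect_one semidirect_inv semidirect_mul.
Proof.
move=> [h g]; rewrite /semidirect_mul /semidirect_one /=.
by rewrite -(lactM (aact_left aa)) !mulgV (lact1 (aact_left aa)) mulgV.
Qed.

HB.instance Definition _ := Choice.copy T (H * G)%type.
HB.instance Definition _ := isGroup.Build T
  semidirect_mulA semidirect_mul1x semidirect_mulx1
  semidirect_mulVx semidirect_mulxV.
End Semidirect.

Definition isom_fixing (H G : groupType)
    (a : G -> H -> H) (aa : autom_action a)
    (a' : G -> H -> H) (b' : G -> H -> G) (mp : matched_pair a' b')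
    (psi : bicrossed mp -> semidirect aa) : Prop :=
  group_isom psi /\ forall h : H, psi (h, 1) = (h, 1).

Definition trivial_right_action (H G : groupType) (b : G -> H -> G) : Prop :=
  forall g h, b g h = g.

Definition deforming_pair (H G : groupType) (a a' : G -> H -> H)
    (r : G -> H) (v : G -> G) : Prop :=
  [/\ group_isom v,
      forall g1 g2, r (g1 * g2) = r g1 * a (v g1) (r g2)
    & forall g h, a' g h = r g * a (v g) h * (r g)^-1].

(* Main.v *)
Require Import Defs.
From mathcomp Require Import all_boot.

(** Since [(h, g) = (h, 1) * (1, g)] in the bicrossed product, a morphism [psi]
    that fixes [H] is determined by [psi (1, g) = (r g, v g)]: it sends [(h, g)]
    to [(h * r g, v g)] ([fixing_morphismE]).  Such a map [psi] is bijective
    exactly when [v] is, because its first component is a translation of [H]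
    for fixed [g] ([twist_bij], [bij_twist]).

    Applying [psi] to [(1, g) * (h, 1) = (a' g h, b' g h)] gives
    [v (b' g h) = v g] in the second component, so injectivity of [v] makes [b']
    trivial; the first component is then [a' g h * r g = r g * a (v g) h], the
    conjugation formula for [a'].  Applying [psi] to [(1, g1) * (1, g2)] gives
    multiplicativity of [v] and the cocycle identity for [r]
    ([isom_fixing_deforming]).

    Conversely, the cocycle identity for [r] is what makes the conjugated action
    [a'] an action, so that it forms a matched pair with the trivial [b']
    ([deforming_matched_pair]), and what makes [(h, g) |-> (h * r g, v g)]
    multiplicative ([deforming_isom_fixing]). *)

Set Implicit Arguments.
Unset Strict Implicit.
Unset Printing Implicit Defensive.

Local Open Scope group_scope.

Section Twist.
Variables (H G : groupType) (r : G -> H) (v : G -> G).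

Lemma twist_bij (psi : H * G -> H * G) :
    (forall h g, psi (h, g) = (h * r g, v g)) ->
  bijective v -> bijective psi.
Proof.
move=> psiE [w vK wK].
exists (fun x => (x.1 * (r (w x.2))^-1, w x.2)) => -[h g].
  by rewrite psiE /= vK mulgK.
by rewrite psiE /= wK mulgVK.
Qed.

Lemma bij_twist (psi : H * G -> H * G) :
    (forall h g, psi (h, g) = (h * r g, v g)) ->
  bijective psi -> bijective v.
Proof.
move=> psiE [phi psiK phiK].
have v_inj : injective v.
  move=> g1 g2 eq_v.
  have : psi ((r g1)^-1, g1) = psi ((r g2)^-1, g2).
    by rewrite !psiE !mulVg eq_v.
  by case/(can_inj psiK).
have vK g : v (phi (1, g)).2 = g.
  have := phiK (1, g); case: (phi (1, g)) => h' g' /=.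
  by rewrite psiE => -[].
by exists (fun g => (phi (1, g)).2) => // g; apply: v_inj; rewrite vK.
Qed.

End Twist.

Section Deformation.
Variables (H G : groupType) (a : G -> H -> H) (aa : autom_action a).
Variables (a' : G -> H -> H) (b' : G -> H -> G).

Lemma bicrossed_mulE (mp : matched_pair a' b') h1 g1 h2 g2 :
  ((h1, g1) : bicrossed mp) * (h2, g2) = (h1 * a' g1 h2, b' g1 h2 * g2).
Proof. by []. Qed.

Lemma semidirect_mulE h1 g1 h2 g2 :
  ((h1, g1) : semidirect aa) * (h2, g2) = (h1 * a g1 h2, g1 * g2).
Proof. by []. Qed.

Lemma fixing_morphismE (mp : matched_pair a' b')
    (psi : bicrossed mp -> semidirect aa) :
    {morph psi : x y / x * y} -> (forall h, psi (h, 1) = (h, 1)) ->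
  forall h g, psi (h, g) = (h * (psi (1, g)).1, (psi (1, g)).2).
Proof.
move=> psiM psiH h g.
have -> : (h, g) = ((h, 1) : bicrossed mp) * (1, g).
  by rewrite bicrossed_mulE (mp_act1 mp) (mp_1act mp) mulg1 mul1g.
rewrite psiM psiH; case: (psi (1, g)) => h' g'.
by rewrite semidirect_mulE (lact1 (aact_left aa)) mul1g.
Qed.

Lemma isom_fixing_deforming (mp : matched_pair a' b')
    (psi : bicrossed mp -> semidirect aa) :
    isom_fixing psi ->
  trivial_right_action b' /\
  exists (r : G -> H) (v : G -> G), deforming_pair a a' r v /\
    forall h g, psi (h, g) = (h * r g, v g).
Proof.
move=> [[[psi1 psiM] psi_bij] psiH].
pose r g := (psi (1, g)).1; pose v g := (psi (1, g)).2.
have psiE h g : psi (h, g) = (h * r g, v g) by apply: fixing_morphismE.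
have v_bij : bijective v := bij_twist psiE psi_bij.
have swap g h : (a' g h * r (b' g h), v (b' g h)) = (r g * a (v g) h, v g).
  have := psiM (1, g) (h, 1).
  by rewrite bicrossed_mulE psiH !psiE semidirect_mulE !mul1g !mulg1.
have b'_triv : trivial_right_action b'.
  by move=> g h; apply: (bij_inj v_bij); case: (swap g h).
have mult g1 g2 : (r (g1 * g2), v (g1 * g2))
                  = (r g1 * a (v g1) (r g2), v g1 * v g2).
  have := psiM (1, g1) (1, g2).
  by rewrite bicrossed_mulE !psiE semidirect_mulE (mp_act1 mp) b'_triv !mul1g.
split=> //; exists r, v; split=> //; split.
- split=> //; split; last by move=> g1 g2; case: (mult g1 g2).
  by rewrite /v psiH.
- by move=> g1 g2; case: (mult g1 g2).
by move=> g h; case: (swap g h); rewrite b'_triv => <- _; rewrite mulgK.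
Qed.

Section Converse.
Variables (r : G -> H) (v : G -> G).
Hypothesis b'_triv : trivial_right_action b'.
Hypothesis rv : deforming_pair a a' r v.

Lemma deforming_r1 : r 1 = 1.
Proof.
case: rv => -[[v1 _] _] rM _; apply: (mulgI (r 1)).
by have := rM 1 1; rewrite v1 (lact1 (aact_left aa)) !mulg1 => <-.
Qed.

Lemma deforming_matched_pair : matched_pair a' b'.
Proof.
case: (rv) => -[[v1 vM] _] rM a'E; split.
- split=> [h | g1 g2 h].
    by rewrite a'E deforming_r1 v1 (lact1 (aact_left aa)) invg1 mulg1 mul1g.
  rewrite !a'E rM vM (lactM (aact_left aa)) !(aactM aa) invgM.
  (* [a (v g1)] is an automorphism, hence commutes with inversion. *)
  have -> : (a (v g1) (r g2))^-1 = a (v g1) (r g2)^-1.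
    by apply: (mulgI (a (v g1) (r g2))); rewrite mulgV -(aactM aa) mulgV aact1.
  by rewrite !mulgA.
- by split=> [g | g h1 h2]; rewrite !b'_triv.
- by move=> g h1 h2; rewrite b'_triv !a'E (aactM aa) !mulgA mulgVK.
by move=> g1 g2 h; rewrite !b'_triv.
Qed.

Lemma deforming_isom_fixing (mp : matched_pair a' b')
    (psi : bicrossed mp -> semidirect aa) :
  (forall h g, psi (h, g) = (h * r g, v g)) -> isom_fixing psi.
Proof.
case: (rv) => -[[v1 vM] v_bij] rM a'E psiE.
have psiH h : psi (h, 1) = (h, 1) by rewrite psiE deforming_r1 v1 mulg1.
split=> //; split; last exact: twist_bij psiE v_bij.
split=> [|[h1 g1] [h2 g2]]; first exact: psiH.
rewrite bicrossed_mulE !psiE semidirect_mulE b'_triv vM a'E rM (aactM aa).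
by rewrite !mulgA mulgVK.
Qed.

End Converse.
End Deformation.

Theorem corollary3p4 (H G : groupType)
    (alpha : G -> H -> H) (aa : autom_action alpha)
    (alpha' : G -> H -> H) (beta' : G -> H -> G) :
  ((exists (mp : matched_pair alpha' beta')
           (psi : bicrossed mp -> semidirect aa), isom_fixing psi)
   <->
   (trivial_right_action beta' /\
    exists (r : G -> H) (v : G -> G), deforming_pair alpha alpha' r v))
  /\
  (forall (mp : matched_pair alpha' beta')
          (psi : bicrossed mp -> semidirect aa),
     isom_fixing psi
     <->
     (trivial_right_action beta' /\
      exists (r : G -> H) (v : G -> G),
        deforming_pair alpha alpha' r v /\
        forall (h : H) (g : G), psi (h, g) = (h * r g, v g))).
Proof.
split; last first.
  move=> mp psi; split; first exact: isom_fixing_deforming.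
  by move=> [b'_triv [r [v [rv psiE]]]]; apply: deforming_isom_fixing rv _ _ psiE.
split=> [[mp [psi /isom_fixing_deforming[b'_triv [r [v [rv _]]]]]] |].
  by split=> //; exists r, v.
move=> [b'_triv [r [v rv]]].
exists (deforming_matched_pair aa b'_triv rv), (fun x => (x.1 * r x.2, v x.2)).
exact: deforming_isom_fixing rv _ _ _.
Qed.
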